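(* Let $\mathcal A$ and $\mathcal B$ be commutative semisimple Banach algebras and let $\phi:\mathcal B\to\mathcal A$ be a contractive algebra homomorphism with dense range. Then the following statements hold. (i) Let $\sigma\in C_{BSE}(\Delta(\mathcal A\times_\phi\mathcal B))$ and define functions $\tau$ on $\Delta(\mathcal A)$ and $\rho$ on $\Delta(\mathcal B)$ by $$\tau(\varphi)=\sigma(\varphi,\varphi\circ\phi)-\sigma(0,\varphi\circ\phi)\quad\text{and}\quad\rho(\psi)=\sigma(0,\psi)$$ for all $\varphi\in\Delta(\mathcal A)$ and $\psi\in\Delta(\mathcal B)$. Then $\tau\in C_{BSE}(\Delta(\mathcal A))$ and $\rho\in C_{BSE}(\Delta(\mathcal B))$. (ii) Let $\tau\in C_{BSE}(\Delta(\mathcal A))$ and $\rho\in C_{BSE}(\Delta(\mathcal B))$ and define a function $\sigma$ on $\Delta(\mathcal A\times_\phi\mathcal B)$ by $$\sigma(\varphi,\varphi\circ\phi)=\tau(\varphi)+\rho(\varphi\circ\phi)\quad\text{and}\quad\sigma(0,\psi)=\rho(\psi)$$ for all $\varphi\in\Delta(\mathcal A)$ and $\psi\in\Delta(\mathcal B)$. Then $\sigma\in C_{BSE}(\Delta(\mathcal A\times_\phi\mathcal B))$.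
   Context: For a contractive algebra homomorphism $\phi:\mathcal B\to\mathcal A$ between Banach algebras, the $\phi$-Lau product $\mathcal A\times_\phi\mathcal B$ is the space $\mathcal A\times\mathcal B$ with norm $\|(a,b)\|=\|a\|+\|b\|$ and product $(a,b)(a',b')=(aa'+\phi(b)a'+a\phi(b'),\,bb')$. For a commutative Banach algebra $\mathcal C$, $\Delta(\mathcal C)$ is its carrier space (nonzero multiplicative linear functionals, with the Gelfand topology). One has $\Delta(\mathcal A\times_\phi\mathcal B)=E\cup F$ with $E=\{(\varphi,\varphi\circ\phi):\varphi\in\Delta(\mathcal A)\}$ and $F=\{(0,\psi):\psi\in\Delta(\mathcal B)\}$, where $(f,g)$ acts by $(f,g)(a,b)=f(a)+g(b)$. (Density of the range of $\phi$ guarantees $\varphi\circ\phi\in\Delta(\mathcal B)$ for $\varphi\in\Delta(\mathcal A)$.) $C_{BSE}(\Delta(\mathcal C))$ is the set of continuous complex-valued functions $\sigma$ on $\Delta(\mathcal C)$ for which there is a constant $C>0$ with $\left|\sum_{j=1}^n c_j\sigma(\varphi_j)\right|\le C\left\|\sum_{j=1}^n c_j\varphi_j\right\|_{\mathcal C^*}$ for all $n$, all $\varphi_1,\dots,\varphi_n\in\Delta(\mathcal C)$ and all $c_1,\dots,c_n\in\mathbb C$. *)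

(* Defs.v *)
From HB Require Import structures.
From mathcomp Require Import all_boot all_order all_algebra.
From mathcomp Require Import complex.
From mathcomp Require Import all_classical all_reals all_analysis.

Set Implicit Arguments.
Unset Strict Implicit.
Unset Printing Implicit Defensive.

Import Order.TTheory GRing.Theory Num.Theory.
Import numFieldNormedType.Exports.

Local Open Scope classical_set_scope.
Local Open Scope ring_scope.
Local Open Scope complex_scope.

Declare Scope banach_scope.

(* Complex Banach algebras need not be unital, so the product cannot be the
   ring multiplication of MathComp. The norm takes its values in [R[i]]. *)
HB.mixin Record CompleteNormedModule_isBanachAlgebra (R : realType) A
    of CompleteNormedModule R[i] A := {
  bmul : A -> A -> A;
  bmulA : associative bmul;
  bmulDl : left_distributive bmul +%R;
  bmulDr : right_distributive bmul +%R;
  bmulZl : forall (k : R[i]) (x y : A), bmul (k *: x) y = k *: bmul x y;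
  bmulZr : forall (k : R[i]) (x y : A), bmul x (k *: y) = k *: bmul x y;
  normbM : forall x y : A, `|bmul x y| <= `|x| * `|y|
}.

#[short(type="banachAlgType")]
HB.structure Definition BanachAlgebra (R : realType) :=
  {A of CompleteNormedModule R[i] A
   & CompleteNormedModule_isBanachAlgebra R A}.

HB.mixin Record BanachAlgebra_isCommutative (R : realType) A
    of BanachAlgebra R A := {
  bmulC : commutative (@bmul R A)
}.

#[short(type="comBanachAlgType")]
HB.structure Definition ComBanachAlgebra (R : realType) :=
  {A of BanachAlgebra R A & BanachAlgebra_isCommutative R A}.

Notation "x ** y" := (bmul x y) (at level 40, left associativity) : banach_scope.
Local Open Scope banach_scope.

Record contractiveHom (R : realType) (B A : banachAlgType R) := ContractiveHom {
  chom :> {linear B -> A};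
  chomM : forall x y : B, chom (x ** y) = chom x ** chom y;
  chom_contr : forall x : B, `|chom x| <= `|x|
}.

Definition lau (R : realType) (A B : banachAlgType R)
  (phi : contractiveHom B A) : Type := (A * B)%type.

Section LauProduct.
Context {R : realType} {A B : banachAlgType R} (phi : contractiveHom B A).
Local Notation L := (lau phi).

HB.instance Definition _ := GRing.Lmodule.copy L (A * B)%type.

Definition lau_norm (x : L) : R[i] := `|x.1| + `|x.2|.

Lemma lau_normD x y : lau_norm (x + y) <= lau_norm x + lau_norm y.
Proof. by rewrite /lau_norm addrACA lerD ?ler_normD. Qed.

Lemma lau_normZ (k : R[i]) x : lau_norm (k *: x) = `|k| * lau_norm x.
Proof. by rewrite /lau_norm !normrZ mulrDr. Qed.

Lemma lau_norm0_eq0 x : lau_norm x = 0 -> x = 0.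
Proof.
move/eqP; rewrite paddr_eq0 ?normr_ge0// !normr_eq0.
by case: x => a b /= /andP[/eqP -> /eqP ->].
Qed.

HB.instance Definition _ := @Lmodule_isNormed.Build R[i] L
  lau_norm lau_normD lau_normZ lau_norm0_eq0.


Lemma lau_complete (F : set_system L) : ProperFilter F -> cauchy F -> cvg F.
Proof.
move=> FF /cauchy_ballP cF.
have c1 : cvg (fst @ F : set_system A).
  apply/cauchy_cvgP/cauchy_ballP => e e0; near_simpl.
  apply: filterS (cF _ e0) => -[x y] /=; rewrite -!ball_normE /=.
  by apply: le_lt_trans; rewrite lerDl.
have c2 : cvg (snd @ F : set_system B).
  apply/cauchy_cvgP/cauchy_ballP => e e0; near_simpl.
  apply: filterS (cF _ e0) => -[x y] /=; rewrite -!ball_normE /=.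
  by apply: le_lt_trans; rewrite lerDr.
apply/cvg_ex; exists ((lim (fst @ F : set_system A),
  lim (snd @ F : set_system B)) : L).
apply/cvgrPdist_lt => e e0.
have e20 : 0 < e / 2 by rewrite divr_gt0.
have /cvgrPdist_lt/(_ _ e20) h1 := c1.
have /cvgrPdist_lt/(_ _ e20) h2 := c2.
apply: filterS2 h1 h2 => x; rewrite /Num.norm/= /lau_norm/= => ? ?.
by rewrite (splitr e) ltrD.
Qed.

HB.instance Definition _ := Uniform_isComplete.Build L lau_complete.

Definition lau_mul (x y : L) : L :=
  (x.1 ** y.1 + phi x.2 ** y.1 + x.1 ** phi y.2, x.2 ** y.2).

Lemma lau_mulDl : left_distributive lau_mul +%R.
Proof.
move=> x y z; congr pair => /=; rewrite ?linearD/= !bmulDl//.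
by rewrite (addrACA (x.1 ** z.1)) [LHS]addrACA.
Qed.

Lemma lau_mulDr : right_distributive lau_mul +%R.
Proof.
move=> x y z; congr pair => /=; rewrite ?linearD/= !bmulDr//.
by rewrite (addrACA (x.1 ** y.1)) [LHS]addrACA.
Qed.

Lemma lau_mulA : associative lau_mul.
Proof.
move=> x y z; congr pair => /=; last by rewrite bmulA.
rewrite !chomM !(bmulDl, bmulDr) !bmulA -!addrA; congr (_ + _).
rewrite [RHS]addrCA; congr (_ + _).
by rewrite addrCA; congr (_ + _); exact: addrCA.
Qed.

Lemma lau_mulZl (k : R[i]) (x y : L) : lau_mul (k *: x) y = k *: lau_mul x y.
Proof. by congr pair; rewrite /= ?linearZ/= !bmulZl// !scalerDr. Qed.

Lemma lau_mulZr (k : R[i]) (x y : L) : lau_mul x (k *: y) = k *: lau_mul x y.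
Proof. by congr pair; rewrite /= ?linearZ/= !bmulZr// !scalerDr. Qed.

Lemma lau_normM (x y : L) : `|lau_mul x y| <= `|x| * `|y|.
Proof.
rewrite /Num.norm/= /lau_norm/= mulrDl !mulrDr.
rewrite [leRHS]addrA lerD ?normbM// [leRHS]addrAC.
apply: (le_trans (ler_normD _ _)); rewrite lerD//.
  rewrite (le_trans (ler_normD _ _))// lerD ?normbM//.
  by rewrite (le_trans (normbM _ _))// ler_wpM2r// chom_contr.
by rewrite (le_trans (normbM _ _))// ler_wpM2l// chom_contr.
Qed.

HB.instance Definition _ := @CompleteNormedModule_isBanachAlgebra.Build R L
  lau_mul lau_mulA lau_mulDl lau_mulDr lau_mulZl lau_mulZr lau_normM.

End LauProduct.

Lemma lau_mulC (R : realType) (A B : comBanachAlgType R)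
  (phi : contractiveHom B A) : commutative (@lau_mul R A B phi).
Proof.
move=> x y; rewrite /lau_mul (bmulC y.2); congr pair.
by rewrite addrAC (bmulC x.1) (bmulC x.1) (bmulC (phi x.2)).
Qed.

HB.instance Definition _ (R : realType) (A B : comBanachAlgType R)
    (phi : contractiveHom B A) :=
  @BanachAlgebra_isCommutative.Build R (lau phi) (@lau_mulC R A B phi).

Section Semisimple.
Context {R : realType} (A : comBanachAlgType R).

Definition is_ideal (I : set A) :=
  [/\ I 0, forall x y, I x -> I y -> I (x + y),
      forall (k : R[i]) x, I x -> I (k *: x)
    & forall a x, I x -> I (a ** x)].

Definition maximal_modular_ideal (I : set A) :=
  [/\ is_ideal I, I <> setT, exists u, forall x, I (x - u ** x)
    & forall J, is_ideal J -> I `<=` J -> J = I \/ J = setT].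

(* The Jacobson radical of a commutative algebra is the intersection of its
   maximal modular ideals, the whole algebra if there is none. *)
Definition semisimple :=
  \bigcap_(I in [set I | maximal_modular_ideal I]) I = [set 0].

End Semisimple.

Section CarrierSpace.
Context {R : realType} (A : comBanachAlgType R).

(* The Gelfand topology is the topology of pointwise convergence. Continuity of
   the functionals is automatic, and is not part of the definition. *)
Definition carrier : set {ptws A -> R[i]^o} :=
  [set f : A -> R[i] | [/\ scalar f, {morph f : x y / x ** y >-> x * y}
                         & exists x, f x != 0]].

(* Extended, so that it is also meaningful for an unbounded functional. *)
Definition dual_norm (f : A -> R[i]) : \bar R :=
  ereal_sup [set (complex.Re `|f x|)%:E | x in [set x : A | `|x| <= 1]].

(* A function on [carrier] is represented by a total function, of which only
   the restriction to [carrier] matters. *)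
Definition C_BSE (sigma : {ptws A -> R[i]^o} -> R[i]^o) : Prop :=
  {within carrier, continuous sigma} /\
  exists C : R, 0 < C /\
    forall (n : nat) (f : 'I_n -> {ptws A -> R[i]^o}) (c : 'I_n -> R[i]),
      (forall j, carrier (f j)) ->
      ((complex.Re `|\sum_(j < n) c j * sigma (f j)|)%R%:E <=
        C%:E * dual_norm (fun x => \sum_(j < n) c j * f j x)%R)%E.

End CarrierSpace.

Arguments carrier {R} A.

Definition lau_functional (R : realType) (A B : banachAlgType R)
    (phi : contractiveHom B A) (f : A -> R[i]) (g : B -> R[i]) :
  {ptws lau phi -> R[i]^o} := fun x => f x.1 + g x.2.

Arguments lau_functional {R A B} phi f g.

(* Main.v *)
Require Import Defs.
From mathcomp Require Import all_boot all_order all_algebra.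
From mathcomp Require Import complex.
From mathcomp Require Import all_classical all_reals all_analysis.
From mathcomp Require Import ring.
Import Order.TTheory GRing.Theory Num.Theory.
Import numFieldNormedType.Exports.
Local Open Scope classical_set_scope.
Local Open Scope ring_scope.

(** A character [h] of the Lau product is determined by its restrictions
[f = h \o inA phi] and [g = h \o inB phi], since [h (a, b) = f a + g b].
Applying [h] to the product of [(a, 0)] and [(0, b)], which is
[(a ** phi b, 0)], gives [f a * f (phi b) = f a * g b]. So either [f] is not
zero, and then it is a character of [A] with [g = f \o phi] (the diagonal
part of the carrier space), or [f] is zero and [g] is a character of [B]
([carrier_lauP]). Conversely every character [f] of [A] gives a diagonal
character, and [f \o phi] is itself a character of [B]: it is not zero because
[f] is continuous ([carrier_norm]) and the range of [phi] is dense
([carrier_comp]).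

For the BSE inequalities, a linear combination of characters of [A] or of [B]
is compared with one of characters of the Lau product through norm-decreasing
maps. The projections of the product onto its two factors serve to go from
[sigma] to [tau] and [rho]: a combination of [f_j], pulled back along the first
projection, is the difference of the same combinations of the diagonal
characters and of the characters [(0, f_j \o phi)]. The injections [inA] and
[inB] serve for the way back: the combination of the [h_j], restricted to [A],
only sees the diagonal ones, and restricted to [B] it is a combination of
characters of [B]. The constants add up.

For continuity, restriction and extension of functionals are continuous for
pointwise convergence, so the only question is the case distinction that
defines [sigma]. It is harmless because the diagonal part is both open and
closed in the carrier space ([diagonal_near]). *)

(** * Contractivity of characters *)

Section QuasiInverse.
Context {R : realType} {A : banachAlgType R}.
Local Open Scope banach_scope.

Lemma bmulr0 (x : A) : x ** 0 = 0.
Proof. by apply: (addIr (x ** 0)); rewrite -bmulDr !add0r. Qed.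

Lemma bmulrN (x y : A) : x ** (- y) = - (x ** y).
Proof. by apply/eqP; rewrite -subr_eq0 opprK -bmulDr addNr bmulr0. Qed.

Lemma bmulrB (x y z : A) : x ** (y - z) = x ** y - x ** z.
Proof. by rewrite bmulDr bmulrN. Qed.

Lemma complex_expr_small (r e : R[i]) : 0 <= r -> r < 1 -> 0 < e ->
  exists N, forall n, (N <= n)%N -> r ^+ n < e.
Proof.
move=> r0 r1 e0.
have rE : (complex.Re r)%:C%C = r by rewrite RRe_real// ger0_real.
have eE : (complex.Re e)%:C%C = e by rewrite RRe_real// gtr0_real.
have r0' : 0 <= complex.Re r by rewrite -lecR rE.
have r1' : complex.Re r < 1 by rewrite -ltcR rE.
have e0' : 0 < complex.Re e by rewrite -ltcR eE.
have /cvgrPdist_lt/(_ _ e0') : geometric 1 (complex.Re r) n @[n --> \oo] --> 0.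
  by apply: cvg_geometric; rewrite ger0_norm.
move=> [N _ hN]; exists N => n /hN; rewrite /= mul1r sub0r normrN.
by rewrite ger0_norm ?exprn_ge0// -ltcR rmorphXn/= rE eE.
Qed.

Section GeometricSeries.
Context (z : A) (z1 : `|z| < 1).

(* The n-th partial sum of the series z + z ** z + z ** z ** z + ... *)
Let s (n : nat) : A := iter n (fun y => z + z ** y) 0.

(* The sum of the geometric series of the norms. *)
Let M := `|z| / (1 - `|z|).

Let M0 : 0 <= M.
Proof. by rewrite divr_ge0// subr_ge0 ltW. Qed.

Let s_bounded n : `|s n| <= M.
Proof.
elim: n => [|n IH]; first by rewrite /s/= normr0.
have -> : M = `|z| + `|z| * M.
  have z10 : 1 - `|z| != 0 by rewrite subr_eq0 gt_eqF.
  by rewrite /M; field.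
rewrite (le_trans (ler_normD _ _))// lerD2l (le_trans (normbM _ _))//.
by rewrite ler_wpM2l.
Qed.

Let s_tail n k : `|s (n + k) - s n| <= `|z| ^+ n * M.
Proof.
elim: n => [|n IH]; first by rewrite mul1r subr0 s_bounded.
rewrite addSn /s/= opprD addrACA subrr add0r -bmulrB.
by rewrite (le_trans (normbM _ _))// exprS -mulrA ler_wpM2l.
Qed.

Let s_cvg : cvgn s.
Proof.
apply/cauchy_cvgP/cauchy_exP => e e0.
have M1 : 0 < M + 1 by rewrite ltr_wpDl.
have [N hN] := @complex_expr_small `|z| (e / (M + 1)) (normr_ge0 z) z1
  (divr_gt0 e0 M1).
exists (s N); exists N => //= n /= Nn.
rewrite -ball_normE/= distrC -(subnKC Nn) (le_lt_trans (s_tail _ _))//.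
have := hN N (leqnn N); rewrite ltr_pdivlMr//; apply: le_lt_trans.
by rewrite ler_wpM2l ?exprn_ge0// lerDl.
Qed.

(** In the absence of a unit, this replaces the invertibility of [1 - z]. *)
Lemma quasi_inverse : exists y : A, y = z + z ** y.
Proof.
exists (limn s); apply: cvg_lim; first exact: norm_hausdorff.
rewrite -cvg_shiftS; apply/cvgrPdist_lt => e e0.
have /cvgrPdist_lt/(_ _ e0) := s_cvg.
apply: filterS => n /=; apply: le_lt_trans.
rewrite opprD addrACA subrr add0r -bmulrB.
by rewrite (le_trans (normbM _ _))// ler_piMl// ltW.
Qed.
End GeometricSeries.
End QuasiInverse.

Section Characters.
Context {R : realType} {A : comBanachAlgType R}.
Local Open Scope banach_scope.
Implicit Type f : A -> R[i].

Lemma carrierD f x y : carrier A f -> f (x + y) = f x + f y.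
Proof. by move=> [fl _ _]; rewrite -[x in LHS]scale1r fl mul1r. Qed.

Lemma carrier0 f : carrier A f -> f 0 = 0.
Proof. by move=> cf; apply: (addIr (f 0)); rewrite -carrierD// !add0r. Qed.

Lemma carrierZ f k x : carrier A f -> f (k *: x) = k * f x.
Proof.
by move=> cf; have [fl _ _] := cf; rewrite -[_ *: _]addr0 fl carrier0// addr0.
Qed.

(** If [`|x| < `|f x|], then [z := (f x)^-1 *: x] satisfies [`|z| < 1] and
[f z = 1], and applying [f] to [y = z + z ** y] gives [f y = 1 + f y]. *)
Lemma carrier_norm f x : carrier A f -> `|f x| <= `|x|.
Proof.
move=> cf; rewrite real_leNgt ?normr_real//; apply/negP => xfx.
have fx0 : 0 < `|f x| by rewrite (le_lt_trans _ xfx).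
have fxN0 : f x != 0 by rewrite -normr_gt0.
have [|y yE] := @quasi_inverse _ _ ((f x)^-1 *: x).
  by rewrite normrZ normfV mulrC ltr_pdivrMr// mul1r.
have [_ fM _] := cf; have := congr1 f yE.
rewrite carrierD// fM carrierZ// mulVf// mul1r => /eqP.
by rewrite -subr_eq subrr eq_sym oner_eq0.
Qed.

End Characters.

(** Multiplicativity is clear; the point is that [f \o phi] does not vanish.
If [f a] is not zero, some [phi b] lies within [`|f a|] of [a], and as [f] is
contractive it cannot vanish at [phi b]. *)
Lemma carrier_comp (R : realType) (A B : comBanachAlgType R)
  (phi : contractiveHom B A) (f : A -> R[i]) :
  dense (range phi) -> carrier A f -> carrier B (f \o phi).
Proof.
move=> phi_dense cf; have [fl fM [a fa]] := cf; split.
- by move=> k x y /=; rewrite linearP fl.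
- by move=> x y /=; rewrite chomM fM.
have [|y [bax [b _ yE]]] := phi_dense (ball a `|f a|) _ (ball_open _ _).
  by exists a; apply: ballxx; rewrite normr_gt0.
move: bax; rewrite -{y}yE => bax.
exists b; apply/eqP => /= fb0.
move: bax; rewrite -ball_normE/= => /(le_lt_trans (carrier_norm _ _ cf)).
by rewrite -scaleN1r carrierD// carrierZ// fb0 mulr0 addr0 ltxx.
Qed.

(** A contraction [i] maps the unit ball into the unit ball; this is the only
way in which dual norms are compared below. *)
Lemma dual_norm_le (R : realType) (A B : comBanachAlgType R)
    (F : A -> R[i]) (G : B -> R[i]) (i : A -> B) :
  (forall x, `|i x| <= `|x|) -> (forall x, F x = G (i x)) ->
  (dual_norm F <= dual_norm G)%E.
Proof.
move=> ile FG; apply: ge_ereal_sup => _ [x /= x1 <-].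
by apply: ereal_sup_ubound; exists (i x) => /=; rewrite ?FG// (le_trans (ile x)).
Qed.

(** * The carrier space of the Lau product *)

Section Lau.
Context {R : realType} {A B : comBanachAlgType R} (phi : contractiveHom B A).
Implicit Types (f : A -> R[i]) (g : B -> R[i]) (h : lau phi -> R[i]).
Local Open Scope banach_scope.

Definition inA (a : A) : lau phi := (a, 0).
Definition inB (b : B) : lau phi := (0, b).

Lemma inA_norm a : `|inA a| <= `|a|.
Proof. by rewrite /Num.norm/= /lau_norm/= normr0 addr0. Qed.

Lemma inB_norm b : `|inB b| <= `|b|.
Proof. by rewrite /Num.norm/= /lau_norm/= normr0 add0r. Qed.

Lemma snd_norm (x : lau phi) : `|x.2| <= `|x|.
Proof. by rewrite [leRHS]/Num.norm/= /lau_norm/= lerDr. Qed.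

Lemma fst_norm (x : lau phi) : `|x.1| <= `|x|.
Proof. by rewrite [leRHS]/Num.norm/= /lau_norm/= lerDl. Qed.

Lemma lau_mulE (x y : lau phi) : x ** y =
  (x.1 ** y.1 + phi x.2 ** y.1 + x.1 ** phi y.2, x.2 ** y.2) :> lau phi.
Proof. by []. Qed.

Lemma lau_scaleDE (k : R[i]) (x y : lau phi) :
  k *: x + y = (k *: x.1 + y.1, k *: x.2 + y.2) :> lau phi.
Proof. by []. Qed.

Lemma carrier_inr g : carrier B g ->
  carrier (lau phi) (lau_functional phi (cst 0) g).
Proof.
move=> cg; have [gl gM [b gb]] := cg; rewrite /lau_functional; split.
- by move=> k x y; rewrite lau_scaleDE/= !add0r gl.
- by move=> x y; rewrite lau_mulE/= !add0r gM.
- by exists (inB b); rewrite /= add0r.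
Qed.

Lemma carrier_diag f : carrier A f ->
  carrier (lau phi) (lau_functional phi f (f \o phi)).
Proof.
move=> cf; have [fl fM [a fa]] := cf; rewrite /lau_functional; split.
- move=> k x y; rewrite lau_scaleDE/= linearP !fl; ring.
- move=> x y; rewrite lau_mulE/= chomM !(carrierD _ _ _ cf) !fM; ring.
- by exists (inA a); rewrite /= linear0 (carrier0 _ cf) addr0.
Qed.

(** The dichotomy rests on [inA (a ** phi b) = inA a ** inB b]: if
[h (inA a)] is not zero, it can be cancelled from
[h (inA a) * h (inB b) = h (inA a) * h (inA (phi b))]. *)
Lemma carrier_lauP h : carrier (lau phi) h ->
  [\/ exists2 f, carrier A f & h = lau_functional phi f (f \o phi)
    | exists2 g, carrier B g & h = lau_functional phi (cst 0) g].
Proof.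
move=> ch; have [hl hM [x hx]] := ch.
have hE y : h y = h (inA y.1) + h (inB y.2).
  rewrite -carrierD//; congr h; case: y => a b; congr pair => /=.
    by rewrite addr0.
  by rewrite add0r.
have lA k u v : inA (k *: u + v) = k *: inA u + inA v.
  by rewrite lau_scaleDE/= scaler0 addr0.
have lB k u v : inB (k *: u + v) = k *: inB u + inB v.
  by rewrite lau_scaleDE/= scaler0 addr0.
have MA u v : inA (u ** v) = inA u ** inA v.
  rewrite lau_mulE/= linear0 !bmulr0 (bmulC 0) bmulr0 !addr0 //.
have MB u v : inB (u ** v) = inB u ** inB v.
  by rewrite lau_mulE/= (bmulC 0) !bmulr0 (bmulC 0) bmulr0 !addr0.
have MAB a b : inA (a ** phi b) = inA a ** inB b.
  by rewrite lau_mulE/= linear0 (bmulC 0) !bmulr0 (bmulC 0) bmulr0 !add0r.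
have [[a ha]|noA] := pselect (exists a, h (inA a) != 0).
  have cf : carrier A (h \o inA).
    split; [by move=> k u v/=; rewrite lA hl|by move=> u v/=; rewrite MA hM|].
    by exists a.
  left; exists (h \o inA) => //; apply/funext => y; rewrite hE; congr (_ + _).
  by apply: (mulfI ha); rewrite -hM -MAB MA hM.
have hA a : h (inA a) = 0 by apply: contra_notP noA => /eqP; exists a.
right; exists (h \o inB).
  split; [by move=> k u v/=; rewrite lB hl|by move=> u v/=; rewrite MB hM|].
  by exists x.2; move: hx; rewrite hE hA add0r.
by apply/funext => y; rewrite hE hA.
Qed.

End Lau.

(** * Continuity on a subset for pointwise convergence *)

Section PointwiseTopology.
Context {R : realType}.

Lemma ptws_eval_cvg (T : topologicalType) (V : uniformType)
    (f : {ptws T -> V}) (x : T) : g x @[g --> f] --> f x.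
Proof.
have := @cvg_id _ (nbhs f).
by move/(@pointwise_cvgP T V (nbhs f)); exact.
Qed.

Lemma eval_cvg (T : topologicalType) (f : {ptws T -> R[i]^o}) (x : T) :
  (g x : R[i]^o) @[g --> f] --> (f x : R[i]^o).
Proof. exact: ptws_eval_cvg. Qed.

(** The basic open sets which separate the two parts of the carrier space. *)
Lemma eval_neq0_near (T : topologicalType) (f : {ptws T -> R[i]^o}) (x : T)
    (Q : {ptws T -> R[i]^o} -> Prop) :
  f x != 0 -> (forall g, g x != 0 -> Q g) -> \forall g \near f, Q g.
Proof.
move=> fx Qx; have nf : \forall g \near f, g x != 0.
  exact: (@cvgr_neq0 R[i] R[i]^o _ (nbhs f) _ (fun g => g x) (f x)
    (eval_cvg T f x) fx).
exact: (@filterS _ (nbhs f) _ (fun g => g x != 0) Q Qx nf).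
Qed.

Lemma ptws_continuous (S : topologicalType) (T : topologicalType)
    (Theta : S -> {ptws T -> R[i]^o}) :
  (forall x, continuous (fun s => Theta s x : R[i]^o)) -> continuous Theta.
Proof. by move=> h s; apply/pointwise_cvgP => x; exact: h. Qed.

(** [Theta] has to map [D] into [E] only near [s]: for the functional [sigma]
obtained by gluing, [tau] makes sense on one part of the carrier space
only. *)
Lemma cvg_within_comp (S T U : topologicalType) (D : set S) (E : set T)
    (Theta : S -> T) (sigma : T -> U) (s : S) :
  continuous Theta -> {within E, continuous sigma} -> E (Theta s) ->
  (\forall t \near s, D t -> E (Theta t)) ->
  sigma (Theta t) @[t --> within D (nbhs s)] --> sigma (Theta s).
Proof.
move=> cT /subspace_continuousP/(_ (Theta s)) cs Es DE W nW.
have /cT h := cs Es W nW.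
by apply: filterS2 DE h => t DE h Dt; apply: h; exact: DE.
Qed.

Lemma cvg_within_eq (S T : topologicalType) (D : set S) (F G : S -> T) (s : S) :
  D s -> (\forall t \near s, D t -> F t = G t) ->
  F t @[t --> within D (nbhs s)] --> F s ->
  G t @[t --> within D (nbhs s)] --> G s.
Proof.
move=> Ds FG; rewrite (nbhs_singleton FG Ds) => Fs W nW.
by apply: filterS2 FG (Fs W nW) => t FGt Wt Dt; rewrite /= -FGt//; exact: Wt.
Qed.

Lemma continuous_within_comp (S T U : topologicalType) (D : set S) (E : set T)
    (Theta : S -> T) (sigma : T -> U) :
  continuous Theta -> {within E, continuous sigma} ->
  (forall t, D t -> E (Theta t)) -> {within D, continuous (sigma \o Theta)}.
Proof.
move=> cT cs DE; apply/subspace_continuousP => s Ds.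
apply: (@cvg_within_comp _ _ _ _ E) => //; first exact: DE.
by apply: filterE.
Qed.

End PointwiseTopology.

(** * The BSE inequality *)

Section BSEBound.
Context {R : realType}.

(** The condition on the constant [C] in [C_BSE]. *)
Definition BSE_bound {A : comBanachAlgType R} (C : R)
    (sigma : {ptws A -> R[i]^o} -> R[i]^o) :=
  forall (n : nat) (f : 'I_n -> {ptws A -> R[i]^o}) (c : 'I_n -> R[i]),
    (forall j, carrier A (f j)) ->
    ((complex.Re `|\sum_(j < n) c j * sigma (f j)|)%R%:E <=
      C%:E * dual_norm (fun x => \sum_(j < n) c j * f j x)%R)%E.

(** Restricting to the indices in [P] allows families in which some of the
functionals are not characters, such as the restrictions to [A] of characters
of the Lau product. *)
Lemma BSE_bound_on {A : comBanachAlgType R} {C : R}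
    {sigma : {ptws A -> R[i]^o} -> R[i]^o} : BSE_bound C sigma ->
  forall (n : nat) (P : pred 'I_n) (f : 'I_n -> {ptws A -> R[i]^o})
    (c : 'I_n -> R[i]), (forall j, P j -> carrier A (f j)) ->
    ((complex.Re `|\sum_(j < n | P j) c j * sigma (f j)|)%R%:E <=
      C%:E * dual_norm (fun x => \sum_(j < n | P j) c j * f j x)%R)%E.
Proof.
move=> bC n P f c cf.
have := bC _ (f \o @enum_val _ P) (c \o @enum_val _ P)
  (fun j => cf _ (enum_valP j)).
rewrite -(big_enum_val (fun j => c j * sigma (f j))).
congr (_ <= _ * dual_norm _)%E; apply/funext => x.
by rewrite -(big_enum_val (fun j => c j * f j x)).
Qed.

Lemma leeD_Re_norm (x y : R[i]) :
  ((complex.Re `|(x + y)%R|)%:E <= (complex.Re `|x|)%:E + (complex.Re `|y|)%:E)%E.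
Proof.
rewrite -EFinD lee_fin; have := ler_normD x y.
by rewrite lecE => /andP[_]; rewrite raddfD.
Qed.

End BSEBound.

(** * From the Lau product to its factors *)

Section Restriction.
Context {R : realType} {A B : comBanachAlgType R} (phi : contractiveHom B A).
Context (phi_dense : dense (range phi)).
Context (sigma : {ptws lau phi -> R[i]^o} -> R[i]^o).

Lemma lau_diag_continuous :
  continuous (fun f : {ptws A -> R[i]^o} => lau_functional phi f (f \o phi)).
Proof.
apply: ptws_continuous => x f; rewrite /lau_functional.
exact: (@cvgD R[i] R[i]^o _ (nbhs f) _ (fun f => f x.1) (fun f => f (phi x.2))
  _ _ (eval_cvg A f x.1) (eval_cvg A f (phi x.2))).
Qed.

Lemma lau_inr_continuous :
  continuous (fun g : {ptws B -> R[i]^o} => lau_functional phi (cst 0) g).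
Proof.
apply: ptws_continuous => x g; rewrite /lau_functional.
exact: (@cvgD R[i] R[i]^o _ (nbhs g) _ (fun=> 0) (fun g => g x.2)
  _ _ (cvg_cst _) (eval_cvg B g x.2)).
Qed.

Lemma precomp_phi_continuous :
  continuous (fun f : {ptws A -> R[i]^o} => f \o phi : {ptws B -> R[i]^o}).
Proof. by apply: ptws_continuous => b f; exact: (eval_cvg A f (phi b)). Qed.

(** The combination of the [(0, g_j)] is the combination of the [g_j] pulled back
along the second projection. *)
Lemma C_BSE_snd : C_BSE sigma ->
  C_BSE (fun g : {ptws B -> R[i]^o} => sigma (lau_functional phi (cst 0) g)).
Proof.
move=> [sc [C [C0 sC]]]; split.
  exact: (@continuous_within_comp _ _ _ _ _
    (fun g : {ptws B -> R[i]^o} => lau_functional phi (cst 0) g) sigma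
    lau_inr_continuous sc (carrier_inr phi)).
exists C; split=> // n f c cf.
apply: le_trans (sC n _ c (fun j => carrier_inr _ _ (cf j))) _.
apply: lee_wpmul2l; first by rewrite lee_fin ltW.
apply: (dual_norm_le _ _ _ _ _ (fun x : lau phi => x.2)) => x.
  exact: snd_norm.
by apply: eq_bigr => j _; rewrite /lau_functional add0r.
Qed.

(** As [(f, f \o phi) - (0, f \o phi) = (f, 0)], a combination of [n] values of
the function at hand is one of [2 * n] values of [sigma], whose functional
[sum_j c_j (f_j, 0)] is the pull back of [sum_j c_j f_j] along the first
projection. *)
Lemma C_BSE_fst : C_BSE sigma ->
  C_BSE (fun f : {ptws A -> R[i]^o} =>
    sigma (lau_functional phi f (f \o phi))
    - sigma (lau_functional phi (cst 0) (f \o phi))).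
Proof.
move=> /[dup] /C_BSE_snd[rc _] [sc [C [C0 sC]]]; split.
  have tc := @continuous_within_comp _ _ _ _ _
    (fun f : {ptws A -> R[i]^o} => lau_functional phi f (f \o phi)) sigma
    lau_diag_continuous sc (carrier_diag phi).
  have rpc := @continuous_within_comp _ _ _ _ _
    (fun f : {ptws A -> R[i]^o} => f \o phi : {ptws B -> R[i]^o}) _
    precomp_phi_continuous rc (fun f => carrier_comp _ _ _ phi f phi_dense).
  apply/subspace_continuousP => f cf.
  move/subspace_continuousP: tc => /(_ f cf) tc.
  move/subspace_continuousP: rpc => /(_ f cf).
  exact: cvgB.
exists C; split=> // n f c cf.
pose h (j : 'I_(n + n)) : {ptws lau phi -> R[i]^o} :=
  match fintype.split j with
  | inl i => lau_functional phi (f i) (f i \o phi)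
  | inr i => lau_functional phi (cst 0) (f i \o phi)
  end.
pose d (j : 'I_(n + n)) : R[i] :=
  match fintype.split j with inl i => c i | inr i => - c i end.
have ch j : carrier (lau phi) (h j).
  rewrite /h; case: fintype.split => i; first exact: carrier_diag.
  by apply: carrier_inr; exact: carrier_comp.
have splitl i : fintype.split (lshift n i) = inl i := unsplitK (inl i).
have splitr i : fintype.split (rshift n i) = inr i := unsplitK (inr i).
have sumE (F : {ptws lau phi -> R[i]^o} -> R[i]) :
    \sum_j d j * F (h j) = \sum_(j < n) c j *
      (F (lau_functional phi (f j) (f j \o phi))
       - F (lau_functional phi (cst 0) (f j \o phi))).
  rewrite big_split_ord/= -big_split/=; apply: eq_bigr => i _.
  by rewrite /d /h splitl splitr mulNr mulrBr.
have := sC _ h d ch; rewrite sumE => /le_trans; apply.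
apply: lee_wpmul2l; first by rewrite lee_fin ltW.
apply: (dual_norm_le _ _ _ _ _ (fun x : lau phi => x.1)) => x.
  exact: fst_norm.
rewrite (sumE (fun h => h x)); apply: eq_bigr => j _.
by rewrite /lau_functional add0r addrK.
Qed.

End Restriction.

(** * From the factors to the Lau product *)

Section Gluing.
Context {R : realType} {A B : comBanachAlgType R} (phi : contractiveHom B A).
Context (phi_dense : dense (range phi)).
Context (tau : {ptws A -> R[i]^o} -> R[i]^o).
Context (rho : {ptws B -> R[i]^o} -> R[i]^o).

Definition glues (sigma : {ptws lau phi -> R[i]^o} -> R[i]^o) :=
  (forall f, carrier A f ->
    sigma (lau_functional phi f (f \o phi)) = tau f + rho (f \o phi)) /\
  (forall g, carrier B g ->
    sigma (lau_functional phi (cst 0) g) = rho g).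

Definition restrA (h : {ptws lau phi -> R[i]^o}) : {ptws A -> R[i]^o} :=
  h \o inA phi.
Definition restrB (h : {ptws lau phi -> R[i]^o}) : {ptws B -> R[i]^o} :=
  h \o inB phi.

Lemma restrA_diag f : carrier A f ->
  restrA (lau_functional phi f (f \o phi)) = f.
Proof.
move=> cf; apply/funext => a.
by rewrite /restrA/= /lau_functional/= linear0 (carrier0 _ cf) addr0.
Qed.

Lemma restrA_inr g : carrier B g ->
  restrA (lau_functional phi (cst 0) g) = cst 0.
Proof.
move=> cg; apply/funext => a.
by rewrite /restrA/= /lau_functional/= (carrier0 _ cg) addr0.
Qed.

Lemma restrB_diag f : carrier A f ->
  restrB (lau_functional phi f (f \o phi)) = f \o phi.
Proof.
move=> cf; apply/funext => b.
by rewrite /restrB/= /lau_functional/= (carrier0 _ cf) add0r.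
Qed.

Lemma restrB_inr g : restrB (lau_functional phi (cst 0) g) = g.
Proof. by apply/funext => b; rewrite /restrB/= /lau_functional/= add0r. Qed.

Lemma restrA_continuous : continuous restrA.
Proof. by apply: ptws_continuous => a h; exact: (eval_cvg _ h (inA phi a)). Qed.

Lemma restrB_continuous : continuous restrB.
Proof. by apply: ptws_continuous => b h; exact: (eval_cvg _ h (inB phi b)). Qed.

Definition diagonal (h : {ptws lau phi -> R[i]^o}) : bool :=
  `[< carrier A (restrA h) >].

Lemma diagonalT f : carrier A f -> diagonal (lau_functional phi f (f \o phi)).
Proof. by move=> cf; apply/asboolP; rewrite restrA_diag. Qed.

Lemma diagonalF g : carrier B g ->
  diagonal (lau_functional phi (cst 0) g) = false.
Proof.
move=> cg; apply/asboolP; rewrite restrA_inr// => -[_ _ [x]].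
by rewrite eqxx.
Qed.

Lemma restrB_carrier h : carrier (lau phi) h -> carrier B (restrB h).
Proof.
move=> /carrier_lauP[[f cf ->]|[g cg ->]].
  by rewrite restrB_diag//; exact: carrier_comp.
by rewrite restrB_inr.
Qed.

(** A formula for [sigma] without reference to the decomposition of [h], from
which both the existence of [sigma] and its continuity can be read off. *)
Lemma gluesE sigma h : glues sigma -> carrier (lau phi) h ->
  sigma h = (if diagonal h then tau (restrA h) else 0) + rho (restrB h).
Proof.
move=> [sE sF] /carrier_lauP[[f cf ->]|[g cg ->]].
  by rewrite sE// diagonalT// restrA_diag// restrB_diag.
by rewrite sF// diagonalF// restrB_inr add0r.
Qed.

Lemma glues_exists : exists sigma, glues sigma.
Proof.
exists (fun h => (if diagonal h then tau (restrA h) else 0) + rho (restrB h)).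
split=> [f cf|g cg].
  by rewrite diagonalT// restrA_diag// restrB_diag.
by rewrite diagonalF// restrB_inr add0r.
Qed.

(** Both parts of the carrier space are open in it. Near a diagonal [h], with
[h (inA a)] not zero, this value stays away from zero, whereas it vanishes off
the diagonal part. Near [h = (0, g)], with [g b] not zero, the value at
[(phi b, - b)] stays away from zero, whereas every diagonal functional vanishes
there. *)
Lemma diagonal_near h : carrier (lau phi) h ->
  \forall k \near h, carrier (lau phi) k -> diagonal k = diagonal h.
Proof.
move=> /carrier_lauP[[f cf hE]|[g cg hE]].
  have [_ _ [a fa]] := cf.
  have ha : h (inA phi a) != 0.
    by rewrite hE /lau_functional/= linear0 (carrier0 _ cf) addr0.
  apply: (eval_neq0_near (lau phi) h (inA phi a)) => // k ka ck.
  rewrite hE diagonalT//; have [[f' cf' ->]|[g cg kE]] := carrier_lauP _ _ ck.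
    by rewrite diagonalT.
  by move: ka; rewrite kE /lau_functional/= (carrier0 _ cg) addr0 eqxx.
have [_ _ [b gb]] := cg.
pose x : lau phi := (phi b, - b).
have hx : h x != 0.
  rewrite hE /lau_functional/= add0r -scaleN1r.
  by rewrite (carrierZ _ _ _ cg) mulN1r oppr_eq0.
apply: (eval_neq0_near (lau phi) h x) => // k kx ck.
rewrite hE diagonalF//; have [[f' cf' kE]|[g' cg' ->]] := carrier_lauP _ _ ck.
  move: kx; rewrite kE /lau_functional/= linearN -scaleN1r.
  by rewrite (carrierZ _ _ _ cf') mulN1r subrr eqxx.
by rewrite diagonalF.
Qed.

(** By [diagonal_near], [sigma] agrees near each character with one of the
continuous functions [rho (restrB k)] and [tau (restrA k) + rho (restrB k)].
For the inequality, [inA] and [inB] are isometries along which the functional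
of the [h_j] restricts to those to which the bounds for [tau] and [rho]
apply. *)
Lemma C_BSE_glues sigma : C_BSE tau -> C_BSE rho -> glues sigma ->
  C_BSE sigma.
Proof.
move=> [tc [C [C0 tC]]] [rc [D [D0 rD]]] gs; split.
  apply/subspace_continuousP => h ch.
  have dh := diagonal_near h ch.
  pose F k := (if diagonal h then tau (restrA k) else 0) + rho (restrB k).
  apply: (@cvg_within_eq _ _ (carrier (lau phi)) F sigma h ch).
    apply: filterS dh => k dk ck.
    by rewrite (gluesE _ _ gs ck) (dk ck).
  rewrite /F; apply: cvgD.
    case: ifPn => [dT|_]; last exact: cvg_cst.
    apply: (@cvg_within_comp _ _ _ _ (carrier A) restrA tau h) => //.
    - exact: restrA_continuous.
    - exact/asboolP.
    - by apply: filterS dh => k dk ck; apply/asboolP; move: (dk ck); rewrite dT.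
  have /subspace_continuousP := continuous_within_comp _ _ _ _ _ _ _
    restrB_continuous rc restrB_carrier.
  exact.
exists (C + D); split; first by rewrite addr_gt0.
move=> n h c ch.
pose P j := diagonal (h j).
have -> : \sum_(j < n) c j * sigma (h j) =
    \sum_(j < n | P j) c j * tau (restrA (h j))
    + \sum_(j < n) c j * rho (restrB (h j)).
  rewrite [X in _ = X + _]big_mkcond -big_split/=; apply: eq_bigr => j _.
  by rewrite (gluesE _ _ gs (ch j)) /P mulrDr; case: ifP; rewrite ?mulr0.
rewrite EFinD ge0_muleDl; [|by rewrite lee_fin ltW|by rewrite lee_fin ltW].
apply: le_trans (leeD_Re_norm _ _) _; apply: leeD.
  apply: le_trans (BSE_bound_on tC n P _ c _) _ => [j /asboolP//|].
  apply: lee_wpmul2l; first by rewrite lee_fin ltW.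
  apply: (dual_norm_le _ _ _ _ _ (inA phi)) => a; first exact: inA_norm.
  rewrite big_mkcond/=; apply: eq_bigr => j _; rewrite /P /restrA/=.
  case: ifPn => //; have /carrier_lauP[[f cf ->]|[g cg ->]] := ch j.
    by rewrite diagonalT.
  by rewrite /lau_functional/= (carrier0 _ cg) addr0 mulr0.
apply: le_trans (rD n _ c (fun j => restrB_carrier _ (ch j))) _.
apply: lee_wpmul2l; first by rewrite lee_fin ltW.
by apply: (dual_norm_le _ _ _ _ _ (inB phi)) => // b; exact: inB_norm.
Qed.

End Gluing.

Theorem lemma4p1 (R : realType) (A B : comBanachAlgType R)
  (phi : contractiveHom B A) (ssA : semisimple A) (ssB : semisimple B)
  (phi_dense : dense (range phi)) :
  (forall sigma : {ptws lau phi -> R[i]^o} -> R[i]^o, C_BSE sigma ->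
    C_BSE (fun f : {ptws A -> R[i]^o} =>
      sigma (lau_functional phi f (f \o phi))
      - sigma (lau_functional phi (cst 0) (f \o phi))) /\
    C_BSE (fun g : {ptws B -> R[i]^o} =>
      sigma (lau_functional phi (cst 0) g)))
  /\
  (forall (tau : {ptws A -> R[i]^o} -> R[i]^o)
          (rho : {ptws B -> R[i]^o} -> R[i]^o),
    C_BSE tau -> C_BSE rho ->
    let glues (sigma : {ptws lau phi -> R[i]^o} -> R[i]^o) :=
      (forall f, carrier A f ->
        sigma (lau_functional phi f (f \o phi)) = tau f + rho (f \o phi)) /\
      (forall g, carrier B g ->
        sigma (lau_functional phi (cst 0) g) = rho g) in
    (exists sigma, glues sigma) /\
    (forall sigma, glues sigma -> C_BSE sigma)).
Proof.
split=> [sigma bs|tau rho bt br gl].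
  by split; [exact: C_BSE_fst | exact: C_BSE_snd].
by split=> [|sigma gs]; [exact: glues_exists | exact: C_BSE_glues gs].
Qed.
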